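(* The tropical $R$ satisfies $R(R(x,y))=(x,y)$.
   Context: Let $n\ge 4$. Variables are real; all maps and identities are rational (identities hold wherever both sides are defined). $x=(x_1,\dots,x_n,\bar x_{n-1},\dots,\bar x_1)$, and $y$ is a second tuple of the same form; level $\ell(x)=x_1\cdots x_n\bar x_{n-1}\cdots\bar x_1$; $\delta_{ij}$ Kronecker delta; empty products are $1$. **The $2n\times 2n$ matrix $M(x,z)$.** Write $M_{i,j}=M(x,z)_{i,j}$, $\ell=\ell(x)$, $\bar X_i=1+\bar x_i/x_i$. First column: $M_{1,1}=x_1/\bar x_1$; $M_{i,1}=x_1\cdots x_{i-1}(1+x_i/\bar x_i)$ for $2\le i\le n-1$; $M_{n,1}=x_1\cdots x_n$; $M_{n+1,1}=x_1\cdots x_{n-1}$; $M_{i,1}=\ell/(\bar x_1\cdots\bar x_{2n-i})$ for $n+2\le i\le 2n$. Other columns ($1\le i\le 2n$): $M_{i,j+1}=\frac{M_{i,j}}{x_j}+(\ell z-1)\big(\frac{\delta_{i,j}}{\bar x_j}+\delta_{i,j+1}\big)$ for $1\le j\le n-2$; $M_{i,n}=\frac{M_{i,n-1}}{x_{n-1}}+(\ell z-1)\big(\frac{\delta_{i,n-1}}{\bar x_{n-1}}+\delta_{i,n+1}\big)$; $M_{i,n+1}=\frac{M_{i,n-1}}{x_{n-1}x_n}+(\ell z-1)\big(\frac{\delta_{i,n-1}}{\bar x_{n-1}x_n}+\delta_{i,n}\big)$; $M_{i,2n}=z\frac{\bar x_1}{x_1}M_{i,1}+\delta_{i,2n}\frac{\bar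 x_1}{x_1}(1-\ell z)+\delta_{i,1}z(\ell z-1)$; $M_{i,2n-1}=z\bar x_1\bar X_2M_{i,1}+(1-\ell z)\big(\delta_{i,2n}\bar x_1\bar X_2+\delta_{i,2n-1}\frac{\bar x_2}{x_2}\big)$; $M_{i,2n-j}=\bar x_j\frac{\bar X_{j+1}}{\bar X_j}M_{i,2n+1-j}+(1-\ell z)\big(\delta_{i,2n+1-j}\bar x_j\frac{\bar X_{j+1}}{\bar X_j}+\delta_{i,2n-j}\frac{\bar x_{j+1}}{x_{j+1}}\big)$ for $2\le j\le n-2$. **The tropical $R$.** For generic $(x,y)$ there is a unique $(x',y')$ with $M(x,z)M(y,z)=M(x',z)M(y',z)$ identically in $z$ and $\ell(x)=\ell(y')\ne\ell(y)=\ell(x')$; the resulting birational map $(x,y)\mapsto(x',y')$ is denoted $R$. *)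

(* Defs.v *)
From mathcomp Require Import all_boot all_order all_algebra.
From mathcomp Require Import reals mpoly.

Set Implicit Arguments.
Unset Strict Implicit.
Unset Printing Implicit Defensive.

Import Order.TTheory GRing.Theory Num.Theory.
Local Open Scope ring_scope.

Section RationalMaps.
Variables (K : realType) (m : nat).

Definition generic (A : 'rV[K]_m -> Prop) : Prop :=
  exists P : {mpoly K[m]}, P != 0 /\ forall p : 'rV[K]_m, P.@[p 0] != 0 -> A p.

Definition rat_map : Type := 'I_m -> {fraction {mpoly K[m]}}.

(* A rational function is defined at [p] when some representation of it as a
   quotient of polynomials has a denominator that does not vanish at [p]. *)
Definition maps_to (F : rat_map) (p q : 'rV[K]_m) : Prop :=
  forall i, exists a b : {mpoly K[m]},
    [/\ F i = tofrac a / tofrac b, b.@[p 0] != 0 &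
        q 0 i = a.@[p 0] / b.@[p 0]].

Definition birational (F : rat_map) : Prop :=
  exists G : rat_map,
    generic (fun p => exists q, maps_to F p q /\ maps_to G q p) /\
    generic (fun q => exists p, maps_to G q p /\ maps_to F p q).

End RationalMaps.

Section MatrixM.
Variables (K : realType) (n : nat).

(* (x_1, ..., x_n, \bar x_{n-1}, ..., \bar x_1) *)
Notation vars := 'rV[K]_(n.*2.-1).

Definition coord (x : vars) (k : nat) : K := oapp (x 0) 0 (insub k).

(* x_i for 1 <= i <= n, and \bar x_i for 1 <= i <= n - 1. *)
Definition xv (x : vars) (i : nat) : K := coord x i.-1.
Definition xb (x : vars) (i : nat) : K := coord x (n.*2.-1 - i).

Definition level (x : vars) : K := \prod_i x 0 i.

Definition Xbar (x : vars) (i : nat) : K := 1 + xb x i / xv x i.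

(* No denominator in the formulas for M(x, z) vanishes; division by 0 is total,
   so this has to be required explicitly. *)
Definition M_defined (x : vars) : Prop :=
  (forall i, x 0 i != 0) /\
  (forall j : nat, (2 <= j <= n - 2)%N -> Xbar x j != 0).

Definition kron (i j : nat) : K := (i == j)%:R.

(* In M_first, M_low, M_high and M_entry the row and column numbers [i], [j]
   run from 1 to 2n. *)
Definition M_first (x : vars) (i : nat) : K :=
  if i == 1%N then xv x 1 / xb x 1
  else if (i <= n - 1)%N then
    (\prod_(1 <= k < i) xv x k) * (1 + xv x i / xb x i)
  else if i == n then \prod_(1 <= k < n.+1) xv x k
  else if i == n.+1 then \prod_(1 <= k < n) xv x k
  else level x / \prod_(1 <= k < (n.*2 - i).+1) xb x k.

(* [M_low x z i k] is the entry in column k + 1, for k + 1 <= n - 1. *)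
Fixpoint M_low (x : vars) (z : K) (i k : nat) : K :=
  if k is j.+1 then
    M_low x z i j / xv x j.+1
    + (level x * z - 1) * (kron i j.+1 / xb x j.+1 + kron i j.+2)
  else M_first x i.

(* [M_high x z i k] is the entry in column 2n - (k + 1), for
   1 <= k + 1 <= n - 2. *)
Fixpoint M_high (x : vars) (z : K) (i k : nat) : K :=
  if k is k'.+1 then
    let j := k.+1 in
    let c := xb x j * (Xbar x j.+1 / Xbar x j) in
    c * M_high x z i k'
    + (1 - level x * z) * (kron i (n.*2 + 1 - j) * c
                           + kron i (n.*2 - j) * (xb x j.+1 / xv x j.+1))
  else
    z * xb x 1 * Xbar x 2 * M_first x i
    + (1 - level x * z) * (kron i n.*2 * (xb x 1 * Xbar x 2)
                           + kron i (n.*2 - 1) * (xb x 2 / xv x 2)).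

Definition M_entry (x : vars) (z : K) (i j : nat) : K :=
  if (j <= n - 1)%N then M_low x z i j.-1
  else if j == n then
    M_low x z i (n - 2) / xv x (n - 1)
    + (level x * z - 1) * (kron i (n - 1) / xb x (n - 1) + kron i n.+1)
  else if j == n.+1 then
    M_low x z i (n - 2) / (xv x (n - 1) * xv x n)
    + (level x * z - 1) * (kron i (n - 1) / (xb x (n - 1) * xv x n) + kron i n)
  else if j == n.*2 then
    z * (xb x 1 / xv x 1) * M_first x i
    + kron i n.*2 * (xb x 1 / xv x 1) * (1 - level x * z)
    + kron i 1 * z * (level x * z - 1)
  else M_high x z i (n.*2 - j).-1.

Definition M (x : vars) (z : K) : 'M[K]_(n.*2) :=
  \matrix_(i, j) M_entry x z i.+1 j.+1.

(* A pair (x, y) is the concatenated vector [row_mx x y]. *)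
Definition tropical_R_eqs (p q : 'rV[K]_(n.*2.-1 + n.*2.-1)) : Prop :=
  let x := lsubmx p in let y := rsubmx p in
  let x' := lsubmx q in let y' := rsubmx q in
  [/\ [/\ M_defined x, M_defined y, M_defined x' & M_defined y'],
      forall z : K, M x z *m M y z = M x' z *m M y' z,
      level x = level y',
      level y = level x' &
      level x != level y].

Definition is_tropical_R (R : rat_map K (n.*2.-1 + n.*2.-1)) : Prop :=
  birational R /\
  generic (fun p => exists q,
    [/\ maps_to R p q, tropical_R_eqs p q &
        forall q', tropical_R_eqs p q' -> q' = q]).

End MatrixM.

(* Main.v *)
Require Import Defs.
From mathcomp Require Import all_boot all_order all_algebra.
From mathcomp Require Import boolp reals mpoly.
Local Open Scope ring_scope.

(** The system of equations defining (x', y') = R(x, y) is symmetric under the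
    exchange of (x, y) and (x', y'): the matrix equation is, and so are the
    level conditions l(x) = l(y') and l(y) = l(x'), which also turn
    l(x) != l(y) into l(x') != l(y').  Hence (x, y) is a solution of the system
    whose data are (x', y'); if (x', y') is generic the solution is unique, so
    it is R(x', y').

    Two points need more.  First, for generic (x, y) the image (x', y') has to avoid
    the exceptional hypersurface P = 0 of the uniqueness statement: as R is
    birational it is dominant, so P does not pull back to the zero rational
    function ([generic_preimage]).  Secondly, the identity has to hold wherever
    R(R(x, y)) is defined, not only generically: each coordinate of R o R is a
    rational function which agrees generically with a coordinate function, so
    the two are equal as fractions ([has_value_generic_eq0]), and a fraction has
    only one value at a point ([has_value_inj]).  Both arguments rest on the
    fact that a nonzero polynomial over the infinite field K has a point where
    it does not vanish ([mpoly_eq0_eval]). *)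

Set Implicit Arguments.
Unset Strict Implicit.
Unset Printing Implicit Defensive.

Import Order.TTheory GRing.Theory Num.Theory.

(** * Polynomials over an infinite field *)

Lemma poly_eq0_eval (K : numDomainType) (p : {poly K}) :
  (forall t, p.[t] = 0) -> p = 0.
Proof.
move=> p0; apply: (@roots_geq_poly_eq0 _ _ [seq i%:R | i <- iota 0 (size p)]).
- by apply/allP => _ /mapP[i _ ->]; rewrite /root p0.
- by rewrite map_inj_uniq ?iota_uniq //; apply: mulrIn; rewrite oner_neq0.
- by rewrite size_map size_iota.
Qed.

Lemma widen_ordE (n : nat) (i : 'I_n) :
  widen_ord (leqnSn n) i = lift ord_max i.
Proof. by apply: val_inj; rewrite [RHS]lift_max. Qed.

Definition extend (K : Type) (n : nat) (v : 'I_n -> K) (t : K) (i : 'I_n.+1) :=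
  oapp v t (unlift ord_max i).

Lemma horner_muni (K : comNzRingType) (n : nat) (P : {mpoly K[n.+1]})
    (v : 'I_n -> K) (t : K) :
  (map_poly (meval v) (muni P)).[t] = P.@[extend v t].
Proof.
rewrite muniE mevalE rmorph_sum /= horner_sum; apply: eq_bigr => m _.
rewrite map_polyZ /= map_polyXn hornerZ hornerXn mevalZ mevalX.
rewrite big_ord_recr /= -mulrA; congr (_ * (_ * _)).
  by apply: eq_bigr => i _; rewrite mnmE widen_ordE /extend liftK.
by rewrite /extend unlift_none.
Qed.

Lemma mcoeff_muni (K : comNzRingType) (n : nat) (P : {mpoly K[n.+1]})
    (m : 'X_{1..n.+1}) :
  (muni P)`_(m ord_max)
    @_[multinom m (widen_ord (leqnSn n) i) | i < n] = P@_m.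
Proof.
rewrite muniE coef_sum raddf_sum [in RHS](mpolyE P) raddf_sum /=.
apply: eq_bigr => m' _.
rewrite coefZ coefXn mcoeffZ mcoeffX -scalerAl mcoeffZ; congr (_ * _).
have [->|neq_m] := eqVneq m' m; first by rewrite eqxx mulr1 mcoeffX eqxx.
case: eqP => [eq_max|_]; rewrite ?mulr1 ?mulr0 ?mcoeff0 // mcoeffX.
case: eqP => // /mnmP eq_low; case/eqP: neq_m; apply/mnmP => i.
have [j ->|->] := unliftP ord_max i; last by [].
by have := eq_low j; rewrite !mnmE widen_ordE.
Qed.

(** By induction on the number of variables: viewed as a polynomial in the last
    variable, P has coefficients that vanish identically as functions of the
    others, since a univariate polynomial has finitely many roots. *)
Lemma mpoly_eq0_eval (K : numDomainType) (n : nat) (P : {mpoly K[n]}) :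
  (forall v, P.@[v] = 0) -> P = 0.
Proof.
elim: n P => [|n IHn] P P0.
  apply/mpolyP => m; rewrite mcoeff0 -(P0 (fun=> 0)) mevalE.
  rewrite [in LHS](mpolyE P) raddf_sum /=; apply: eq_bigr => m' _.
  rewrite big_ord0 mulr1 mcoeffZ mcoeffX.
  by have -> : m' = m; [apply/mnmP; case | rewrite eqxx mulr1].
suff muniP0 : muni P = 0.
  by apply/mpolyP => m; rewrite -mcoeff_muni muniP0 coef0 !mcoeff0.
apply/polyP => k; rewrite coef0; apply: IHn => v.
rewrite -(coef_map (meval v)) /= (_ : map_poly _ _ = 0) ?coef0 //.
by apply: poly_eq0_eval => t; rewrite horner_muni P0.
Qed.

Section Fractions.
Variable D : idomainType.
Implicit Types a b c d : D.

Lemma eq_fracP a b c d : b != 0 -> d != 0 ->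
  tofrac a / tofrac b = tofrac c / tofrac d -> a * d = c * b.
Proof.
move=> b0 d0 /eqP; rewrite eqr_div ?tofrac_eq0 //.
by rewrite -!tofracM tofrac_eq => /eqP.
Qed.

Lemma addf_frac a b c d : b != 0 -> d != 0 ->
  tofrac a / tofrac b + tofrac c / tofrac d
    = tofrac (a * d + c * b) / tofrac (b * d).
Proof. by move=> b0 d0; rewrite addf_div ?tofrac_eq0 // tofracD !tofracM. Qed.

Lemma mulf_frac a b c d :
  tofrac a / tofrac b * (tofrac c / tofrac d) = tofrac (a * c) / tofrac (b * d).
Proof. by rewrite mulf_div !tofracM. Qed.

Lemma frac_mulKV a b : b != 0 -> tofrac a = tofrac a / tofrac b * tofrac b.
Proof. by move=> b0; rewrite mulfVK ?tofrac_eq0. Qed.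

Lemma invf_frac a b : (tofrac a / tofrac b)^-1 = tofrac b / tofrac a.
Proof. exact: invf_div. Qed.

End Fractions.

Section RationalFunctions.
Variables (K : realType) (m : nat).
Implicit Types (P : {mpoly K[m]}) (f g : {fraction {mpoly K[m]}}).
Implicit Types (p q r : 'rV[K]_m) (F : rat_map K m).

(** * Values of rational functions *)

Lemma generic_nonempty (A : 'rV[K]_m -> Prop) : generic A -> exists p, A p.
Proof.
move=> [P [P_neq0 PA]].
have [[p Pp]|noP] := pselect (exists p : 'rV[K]_m, P.@[p 0] != 0).
  by exists p; apply: PA.
case/eqP: P_neq0; apply: mpoly_eq0_eval => v; apply/eqP.
apply: contraPT noP => Pv; apply; exists (\row_i v i).
by rewrite (@meval_eq _ _ _ v) // => i; rewrite mxE.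
Qed.

Lemma genericI (A B : 'rV[K]_m -> Prop) :
  generic A -> generic B -> generic (fun p => A p /\ B p).
Proof.
move=> [P [P0 PA]] [Q [Q0 QB]]; exists (P * Q); split; first exact: mulf_neq0.
by move=> p; rewrite mevalM mulf_eq0 negb_or => /andP[/PA ? /QB].
Qed.

Lemma genericS (A B : 'rV[K]_m -> Prop) :
  (forall p, A p -> B p) -> generic A -> generic B.
Proof. by move=> AB [P [P0 PA]]; exists P; split=> // p /PA/AB. Qed.

(** A relation rather than a function, since a fraction has no canonical
    representative; [maps_to F p q] unfolds to [has_value (F i) p (q 0 i)] for
    all i. *)
Definition has_value f p (v : K) : Prop :=
  exists a b : {mpoly K[m]},
    [/\ f = tofrac a / tofrac b, b.@[p 0] != 0 & v = a.@[p 0] / b.@[p 0]].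

Lemma eval_neq0 P p : P.@[p 0] != 0 -> P != 0.
Proof. by apply: contraNneq => ->; rewrite meval0. Qed.

Lemma has_value_inj f p v w : has_value f p v -> has_value f p w -> v = w.
Proof.
move=> [a [b [-> b0 ->]]] [c [d [eq_f d0 ->]]]; apply/eqP.
have eq_ad := eq_fracP (eval_neq0 b0) (eval_neq0 d0) eq_f.
by rewrite eqr_div // -!mevalM eq_ad.
Qed.

Lemma has_value_tofrac P p : has_value (tofrac P) p P.@[p 0].
Proof.
by exists P, 1; split; rewrite ?meval1 ?oner_neq0 // ?tofrac1 divr1.
Qed.

Lemma has_valueC c p : has_value (tofrac c%:MP) p c.
Proof. by have := has_value_tofrac c%:MP p; rewrite mevalC. Qed.

Lemma has_value0 p : has_value 0 p 0.
Proof. by have := has_valueC 0 p; rewrite mpolyC0 tofrac0. Qed.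

Lemma has_value1 p : has_value 1 p 1.
Proof. by have := has_valueC 1 p; rewrite mpolyC1 tofrac1. Qed.

Lemma has_valueD f g p v w :
  has_value f p v -> has_value g p w -> has_value (f + g) p (v + w).
Proof.
move=> [a [b [-> b0 ->]]] [c [d [-> d0 ->]]].
exists (a * d + c * b), (b * d); split.
- exact: addf_frac (eval_neq0 b0) (eval_neq0 d0).
- by rewrite mevalM mulf_neq0.
- by rewrite addf_div // mevalD !mevalM.
Qed.

Lemma has_valueM f g p v w :
  has_value f p v -> has_value g p w -> has_value (f * g) p (v * w).
Proof.
move=> [a [b [-> b0 ->]]] [c [d [-> d0 ->]]].
exists (a * c), (b * d); split.
- exact: mulf_frac.
- by rewrite mevalM mulf_neq0.
- by rewrite mulf_div !mevalM.
Qed.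

Lemma has_valueV f p v : v != 0 -> has_value f p v -> has_value f^-1 p v^-1.
Proof.
move=> v0 [a [b [-> b0 def_v]]]; exists b, a; split.
- exact: invf_frac.
- by apply: contraNneq v0 => a0; rewrite def_v a0 mul0r.
- by rewrite def_v invf_div.
Qed.

Lemma has_valueX f p v k : has_value f p v -> has_value (f ^+ k) p (v ^+ k).
Proof.
move=> fv; elim: k => [|k IHk]; last by rewrite !exprS; apply: has_valueM.
by rewrite !expr0; apply: has_value1.
Qed.

(** The exceptional set is the zero locus of the numerator a of one
    representation a / b of f.  At a point q where b vanishes, f may still have
    a value w through another representation; w is nonzero because the identity
    a = f * b of fractions gives a(q) = w * b(q). *)
Lemma has_value_generic_neq0 f p v : v != 0 -> has_value f p v ->
  generic (fun q => forall w, has_value f q w -> w != 0).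
Proof.
move=> v0 [a [b [def_f b0 def_v]]]; exists a; split=> [|q aq w fw].
  by apply: contraNneq v0 => a0; rewrite def_v a0 meval0 mul0r.
apply: contraNneq aq => w0; apply/eqP.
rewrite -(mul0r b.@[q 0]) -w0; apply: (@has_value_inj (tofrac a) q).
  exact: has_value_tofrac.
rewrite (frac_mulKV a (eval_neq0 b0)) -def_f.
exact: has_valueM fw (has_value_tofrac _ _).
Qed.

Lemma has_value_generic_eq0 f : generic (fun p => has_value f p 0) -> f = 0.
Proof.
move=> f0; have [p [a [b [def_f b0 _]]]] := generic_nonempty f0.
have [a0|a_neq0] := eqVneq a 0; first by rewrite def_f a0 tofrac0 mul0r.
have gen_a : generic (fun q => a.@[q 0] != 0) by exists a.
have [q [fq /eqP[]]] := generic_nonempty (genericI f0 gen_a).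
rewrite -(mul0r b.@[q 0]); apply: (@has_value_inj (tofrac a) q).
  exact: has_value_tofrac.
rewrite (frac_mulKV a (eval_neq0 b0)) -def_f.
exact: has_valueM fq (has_value_tofrac _ _).
Qed.

(** * Pulling back polynomials along a rational map *)

Definition pullback F P : {fraction {mpoly K[m]}} :=
  mmap (fun c => tofrac c%:MP_[m]) F P.

Lemma has_value_pullback F P p q :
  maps_to F p q -> has_value (pullback F P) p P.@[q 0].
Proof.
move=> Fpq; rewrite /pullback /mmap mevalE.
apply: (big_ind2 (fun f v => has_value f p v)).
- exact: has_value0.
- by move=> f v g w; apply: has_valueD.
move=> k _; apply: has_valueM; first exact: has_valueC.
apply: (big_ind2 (fun f v => has_value f p v)).
- exact: has_value1.
- by move=> f v g w; apply: has_valueM.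
by move=> i _; apply: has_valueX; apply: Fpq.
Qed.

(** The inverse of F provides points of the image of F outside any given
    hypersurface P = 0, so that the pullback of P is not identically zero. *)
Lemma generic_preimage F (A : 'rV[K]_m -> Prop) : birational F -> generic A ->
  generic (fun p => forall q, maps_to F p q -> A q).
Proof.
move=> [G [_ genG]] [P [P_neq0 PA]].
have genP : generic (fun q : 'rV[K]_m => P.@[q 0] != 0) by exists P.
have [q [[p [_ Fpq]] Pq]] := generic_nonempty (genericI genG genP).
apply: genericS (has_value_generic_neq0 Pq (has_value_pullback P Fpq)).
move=> p' PFp' q' Fpq'; apply/PA/PFp'.
exact: has_value_pullback Fpq'.
Qed.

(** Writing the i-th coordinate of F as a / b with b nonzero at q, the i-th
    coordinate of F o F is the pullback of a divided by the pullback of b: this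
    quotient has a value both at p and at generic points, where it is the i-th
    coordinate of the point.  Hence it is the fraction 'X_i, whose value at p
    is the i-th coordinate of p. *)
Lemma involutive_everywhere F :
  generic (fun p => exists q, maps_to F p q /\ maps_to F q p) ->
  forall p q r, maps_to F p q -> maps_to F q r -> r = p.
Proof.
move=> invF p q r Fpq Fqr; apply/rowP => i.
have [a [b [def_F bq ->]]] := Fqr i.
pose f := pullback F a / pullback F b.
have f_val p' q' : b.@[q' 0] != 0 -> maps_to F p' q' ->
    has_value f p' (a.@[q' 0] / b.@[q' 0]).
  move=> bq' Fpq'; apply: has_valueM; first exact: has_value_pullback.
  by apply: has_valueV => //; apply: has_value_pullback.
have gen_b := has_value_generic_neq0 bq (has_value_pullback b Fpq).
suff fX : f = tofrac 'X_i.
  apply: has_value_inj (f_val _ _ bq Fpq) _.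
  by have := has_value_tofrac 'X_i p; rewrite mevalXU fX.
apply/eqP; rewrite -subr_eq0; apply/eqP/has_value_generic_eq0.
apply: genericS (genericI invF gen_b) => p' [[q' [Fpq' Fqp']] bFp'].
have bq' : b.@[q' 0] != 0 by apply/bFp'/has_value_pullback.
have p'i : p' 0 i = a.@[q' 0] / b.@[q' 0].
  by apply: has_value_inj (Fqp' i) _; exists a, b.
rewrite -(subrr (p' 0 i)) {1}p'i; apply: has_valueD; first exact: f_val.
by have := has_value_tofrac (- 'X_i) p'; rewrite mevalN mevalXU tofracN.
Qed.

End RationalFunctions.

(** * The tropical R *)

Lemma tropical_R_eqs_sym (K : realType) (n : nat)
    (p q : 'rV[K]_(n.*2.-1 + n.*2.-1)) :
  tropical_R_eqs p q -> tropical_R_eqs q p.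
Proof.
move=> [[Dx Dy Dx' Dy'] eqM lx ly neq_l]; split=> //.
by rewrite -ly -lx eq_sym.
Qed.

(* The composite R o R is generically defined and the identity, and the
   identity R(R(x,y)) = (x,y) holds wherever its left side is defined. *)
Theorem proposition4p7 (K : realType) (n : nat) (hn : (4 <= n)%N)
    (R : rat_map K (n.*2.-1 + n.*2.-1)) (hR : is_tropical_R R) :
  generic (fun p => exists q, maps_to R p q /\ maps_to R q p) /\
  (forall (x y x' y' x'' y'' : 'rV[K]_(n.*2.-1)),
     maps_to R (row_mx x y) (row_mx x' y') ->
     maps_to R (row_mx x' y') (row_mx x'' y'') ->
     (x'', y'') = (x, y)).
Proof.
have [birR genR] := hR.
have invR : generic (fun p => exists q, maps_to R p q /\ maps_to R q p).
  apply: genericS (genericI genR (generic_preimage birR genR)).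
  move=> p [[q [Rpq eqs_pq _]] /(_ q Rpq)[r [Rqr _ r_uniq]]].
  by exists q; split=> //; rewrite (r_uniq _ (tropical_R_eqs_sym eqs_pq)).
split=> // x y x' y' x'' y'' Rxy Rxy'.
by have /eq_row_mx[-> ->] := involutive_everywhere invR Rxy Rxy'.
Qed.
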